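(* For every $d \in \mathbb{Z}_{\geq 1}$ we have $$ \widetilde{\mathbf{T}}_d^\infty = 2^d\sum_{T \in \mathfrak{T}^{\mathrm{un}}_d}\frac{(-1)^{|V_{\mathrm{in}}(T) \setminus V_{\mathrm{mov}}(T)|}}{|\mathrm{Aut}(T)|} \cdot \prod_{v \in V_{\mathrm{in}}(T)}\left(\frac{(3\ell(v)-1)!}{\left(3\ell(v) - |v| +1\right)!}\right)\cdot \prod_{v \in V_{\mathrm{mov}}(T)} \left(2^{-\ell(v)}\binom{2\ell(v)}{\ell(v)}-1\right), $$ where $|v|$ denotes the valency of $v$ (the number of edges of $T$ having $v$ as an endpoint), and empty products are equal to $1$.
   Context: **The counts.** $\mathbf{T}_d^a \in \mathbb{Q}$ denotes the ellipsoidal superpotential of $\mathbb{CP}^2$ in degree $d$ with ellipsoid shape $(1,a)$, defined as follows for $a>0$ irrational. Let $E(a_1,a_2) = \{(z_1,z_2) \in \mathbb{C}^2 : \pi(|z_1|^2/a_1 + |z_2|^2/a_2) \leq 1\}$. Choose a symplectic embedding $\iota: E(\epsilon,\epsilon a) \hookrightarrow \mathbb{CP}^2$ for some small $\epsilon>0$, let $M_a$ be $\mathbb{CP}^2$ minus the image under $\iota$ of the interior of $E(\epsilon,\epsilon a)$, and let $\widehat{M}_a = M_a \cup (\mathbb{R}_{\leq 0} \times \partial M_a)$ be its symplectic completion, with an admissible almost complex structure $J$ in the sense of symplectic field theory. Then $\mathbf{T}_d^a$ is the (in general virtual) count of index zero finite energy $J$-holomorphic planes $u : \mathbb{C} \to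 \widehat{M}_a$ in homology class $d[L]$, where $[L] \in H_2(\mathbb{CP}^2)$ is the line class. For rational $a$, $\mathbf{T}_d^a := \mathbf{T}_d^{a+\delta}$ for $\delta>0$ sufficiently small. Put $\mathbf{T}_d^\infty := \mathbf{T}_d^a$ for $a \gg d$ (this is independent of such $a$), and $$\widetilde{\mathbf{T}}_d^\infty := (3d-1)\,\mathbf{T}_d^\infty.$$ It is a known theorem (from earlier work of Mikhalkin and Siegel, specialized to $a \gg d$) that these numbers satisfy, and hence are uniquely determined by, the recursion $$\widetilde{\mathbf{T}}_d^\infty = (3d-1)!\left( (d!)^{-3} - \sum_{\substack{k \geq 2,\ d_1,\dots,d_k \in \mathbb{Z}_{\geq 1}\\ d_1 + \cdots + d_k = d}} \frac{\widetilde{\mathbf{T}}_{d_1}^\infty \cdots \widetilde{\mathbf{T}}_{d_k}^\infty}{k!\,(3d-k)!}\right), \qquad d \in \mathbb{Z}_{\geq 1}.$$ **Trees.** For $k \geq 1$, $\mathfrak{T}^{\mathrm{un}}_k$ is the set of isomorphism classes of finite rooted trees with $k$ unordered leaves and no bivalent vertices. Such a tree $T$ has a distinguished root vertex (which is univalent, i.e. attached to a single ''root edge'', and is not counted as a leaf) and $k$ leaf vertices (the other univalent vertices); the remaining vertices are called internal, and the set of internal vertices is $V_{\mathrm{in}}(T)$. Thus every internal vertex has valency at least $3$. (For instance, the unique element of $\mathfrak{T}^{\mathrm{un}}_1$ is a single edge joining a leaf to the root, with no internal vertices, and the unique element of $\mathfrak{T}^{\mathrm{un}}_2$ has exactly one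 internal vertex, of valency $3$.) $\mathrm{Aut}(T)$ is the group of automorphisms of the rooted tree $T$. All edges are oriented towards the root, and a vertex $v$ is above $w$ if $w$ lies on the oriented path from $v$ to the root. An internal vertex is movable if there are no (other) internal vertices above it; $V_{\mathrm{mov}}(T) \subset V_{\mathrm{in}}(T)$ is the set of movable vertices. The leaf number $\ell(v)$ of a vertex $v$ is the number of leaf vertices lying above $v$, including possibly $v$ itself (so $\ell(v)=1$ if $v$ is a leaf). *)

(* Defs.v *)
From HB Require Import structures.
From mathcomp Require Import all_boot all_order all_fingroup all_algebra.
From mathcomp Require Import zify.

Set Implicit Arguments.
Unset Strict Implicit.
Unset Printing Implicit Defensive.

Import Order.TTheory GRing.Theory Num.Theory.
Local Open Scope ring_scope.

(* [T d] stands for the degree [d] ellipsoidal superpotential of CP^2 in the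
   limit of infinitely long ellipsoids. *)
Definition tildeT (T : nat -> rat) (d : nat) : rat := (3 * d%:R - 1) * T d.

(* The Mikhalkin-Siegel recursion, which determines [T d] for all [d >= 1].
   The parts [c i] are positive with sum [d], so [k <= d]: the sum over all
   [k >= 2] stops at [d], parts fit in ['I_d.+1], and [3 * d - k] does not
   truncate. *)
Definition superpotential_recursion (T : nat -> rat) : Prop :=
  forall d : nat, (0 < d)%N ->
  tildeT T d =
    ((3 * d - 1)`!)%:R *
    ((d`!)%:R ^- 3 -
     \sum_(2 <= k < d.+1)
       \sum_(c : {ffun 'I_k -> 'I_d.+1} |
               [forall i, (0 < c i)%N] && (\sum_(i < k) c i == d)%N)
         (\prod_(i < k) tildeT T (c i)) /
         ((k`!)%:R * ((3 * d - k)`!)%:R)).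

(* A rooted tree with vertex set ['I_n] is given by its root and its parent
   map, which sends each vertex to the target of its edge towards the root;
   the root, having no such edge, is by convention its own parent. *)
Definition rtree (n : nat) : Type := ('I_n * {ffun 'I_n -> 'I_n})%type.

Section Trees.
Variable n : nat.
Implicit Types (t : rtree n) (u v w : 'I_n) (s : 'S_n).

Definition troot t : 'I_n := t.1.
Definition parent t : {ffun 'I_n -> 'I_n} := t.2.

(* [above t v w]: [w] lies on the path from [v] to the root; reflexive. *)
Definition above t v w : bool := fconnect (parent t) v w.

Definition is_rtree t : bool :=
  (parent t (troot t) == troot t) && [forall v, above t v (troot t)].

Definition adj t v w : bool :=
  (v != w) && ((parent t v == w) || (parent t w == v)).

Definition valency t v : nat := #|[set w | adj t v w]|.

Definition leaves t : {set 'I_n} := [set v | (v != troot t) && (valency t v == 1%N)].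

Definition Vin t : {set 'I_n} := ~: (troot t |: leaves t).

Definition Vmov t : {set 'I_n} :=
  [set v in Vin t | [forall u in Vin t, (u != v) ==> ~~ above t u v]].

Definition leaf_number t v : nat := #|[set u in leaves t | above t u v]|.

Definition is_isom s t1 t2 : bool :=
  (s (troot t1) == troot t2) && [forall v, s (parent t1 v) == parent t2 (s v)].

Definition isomorphic t1 t2 : bool := [exists s, is_isom s t1 t2].

Definition Aut_tree t : {set 'S_n} := [set s | is_isom s t t].

Definition un_trees (k : nat) : {set rtree n} :=
  [set t | [&& is_rtree t, valency t (troot t) == 1%N,
               #|leaves t| == k & [forall v, valency t v != 2%N]]].

(* One representative of each isomorphism class. *)
Definition un_classes (k : nat) : {set rtree n} :=
  transversal (equivalence_partition isomorphic (un_trees k)) (un_trees k).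

(* No truncation occurs: an internal vertex [v] has
   [3 <= valency t v <= (leaf_number t v).+1]. *)
Definition tree_weight t : rat :=
  (-1) ^+ #|Vin t :\: Vmov t| / #|Aut_tree t|%:R *
  (\prod_(v in Vin t)
     (((3 * leaf_number t v - 1)`!)%:R /
      ((3 * leaf_number t v - valency t v + 1)`!)%:R)) *
  (\prod_(v in Vmov t)
     (2 ^- leaf_number t v *
      'C(2 * leaf_number t v, leaf_number t v)%:R - 1)).

Lemma isomorphic_equiv : equivalence_rel isomorphic.
Proof.
apply/equivalence_relP; split=> [t|t1 t2 /existsP[s /andP[/eqP sr /forallP sp]] t3].
  apply/existsP; exists 1%g; rewrite /is_isom perm1 eqxx /=.
  by apply/forallP=> v; rewrite !perm1.
apply/idP/idP=> /existsP[s' /andP[/eqP sr' /forallP sp']]; apply/existsP.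
  exists (s^-1 * s')%g; rewrite /is_isom permM -sr permK sr' eqxx /=.
  apply/forallP=> v; rewrite !permM -{1}[v](permKV s) -(eqP (sp _)) permK.
  exact: sp'.
exists (s * s')%g; rewrite /is_isom permM sr sr' eqxx /=.
by apply/forallP=> v; rewrite !permM (eqP (sp v)).
Qed.

Lemma un_classesP k :
  is_transversal (un_classes k)
    (equivalence_partition isomorphic (un_trees k)) (un_trees k).
Proof.
apply/transversalP/equivalence_partitionP.
by move=> x y z _ _ _; apply: isomorphic_equiv.
Qed.

(* Hence the trees with [k] leaves and no bivalent vertices are all found,
   up to isomorphism, among the [un_trees n k] with [n < (2 * k).+1]. *)
Lemma un_trees_size k t : t \in un_trees k -> (n <= 2 * k)%N.
Proof.
rewrite inE => /and4P[/andP[/eqP fr /forallP conn] /eqP vr /eqP Lk /forallP nb].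
have fixr v : parent t v = v -> v = troot t.
  move=> fv; have := conn v; rewrite /above => /iter_findex <-.
  by elim: (findex _ _ _) => //= m <-.
have rL : troot t \notin leaves t by rewrite inE eqxx.
have cardV : (n = k.+1 + #|Vin t|)%N.
  by rewrite -{1}(card_ord n) -(cardsC (troot t |: leaves t)) cardsU1 rL Lk.
have val_int v : v \in Vin t -> (3 <= valency t v)%N.
  rewrite !inE negb_or negb_and negbK => /andP[vr0 /orP[/eqP/eqP|v1]].
    by rewrite (negPf vr0).
  have : (0 < valency t v)%N.
    apply/card_gt0P; exists (parent t v); rewrite inE /adj eqxx andbT.
    by apply: contraNneq vr0 => e; apply/eqP/fixr.
  by case: (valency t v) v1 (nb v) => [|[|[|m]]].
have lo : (k.+1 + 3 * #|Vin t| <= \sum_v valency t v)%N.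
  rewrite (bigID (mem (troot t |: leaves t))) /= leq_add //.
    have -> : k.+1 = #|troot t |: leaves t| by rewrite cardsU1 rL Lk.
    rewrite -sum1_card leq_sum // => v; rewrite !inE.
    by case/orP=> [/eqP->|/andP[_ /eqP->]]; rewrite ?vr.
  rewrite mulnC -sum_nat_const.
  rewrite [X in (_ <= X)%N](eq_bigl (mem (Vin t))); last by move=> v; rewrite !inE.
  exact: leq_sum.
have hi : (\sum_v valency t v <= 2 * n.-1)%N.
  pose E v w : nat := (v != w) && (parent t v == w).
  have sumE : (\sum_v \sum_w E v w <= n.-1)%N.
    have -> : n.-1 = #|predC1 (troot t)| by rewrite cardC1 card_ord.
    rewrite -sum1_card [X in (_ <= X)%N]big_mkcond.
    apply: leq_sum => v _; rewrite (bigD1 (parent t v)) //= big1 ?addn0; last first.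
      by move=> w ne; rewrite /E eq_sym in ne *; rewrite (negPf ne) andbF.
    rewrite /E eqxx andbT inE; case: (eqVneq v (troot t)) => [->|_] /=.
      by rewrite fr eqxx.
    exact: leq_b1.
  apply: (@leq_trans (\sum_v \sum_w (E v w + E w v))%N).
    apply: leq_sum => v _; rewrite /valency -sum1_card big_mkcond /=.
    apply: leq_sum => w _; rewrite inE /adj /E (eq_sym w v).
    by case: (v != w); case: (parent t v == w); case: (parent t w == v).
  rewrite (eq_bigr (fun v => \sum_w E v w + \sum_w E w v)%N); last first.
    by move=> v _; rewrite big_split.
  rewrite big_split /= [X in (_ + X <= _)%N]exchange_big /= mul2n -addnn.
  exact: leq_add.
by have := leq_trans lo hi; lia.
Qed.

End Trees.

(* Main.v *)
Require Import Defs.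
From HB Require Import structures.
From mathcomp Require Import all_boot all_order all_fingroup all_algebra.
From mathcomp Require Import zify ring.

(** Dividing by [2 ^ d] turns the recursion for [tildeT T d] into a
    decomposition of trees at the vertex next to the root.  With
    [y d = tildeT T d / 2 ^ d], moving the terms with [k >= 2] parts to the
    right gives, for [d >= 2],
      [y d = (3 d - 1)! / (2 ^ d d!^3)
             - sum_(k, c) (3 d - 1)! / (k! (3 d - k)!) prod_i y (c i)].
    The composition of [d] into [d] parts contributes
    [- (3 d - 1)! / (d! (2 d)!)], and together with the constant term this is
    [(3 d - 1)! / (d! (2 d)!) (2 ^ - d 'C(2 d, d) - 1)], the factor of a movable
    vertex with [d] leaves above it.  Every other composition stands for a vertex
    that is not movable, whence the sign.  So [y d] is a weighted sum over plane
    trees, where each vertex with [k] children carries an extra [1 / k!]: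
    lemma [tildeT_plane_sum].

    It remains to pass from plane trees, weighted by [1 / prod_v k_v!], to
    isomorphism classes of rooted trees, weighted by [1 / |Aut|].  Both are
    compared with trees on the vertex set ['I_n], weighted by [1 / n!].
    - By orbit-stabilizer, an isomorphism class has [n! / |Aut|] members
      ([sum_un_classes]).
    - A tree on ['I_n] has [prod_v k_v!] orderings of its sets of children, and
      a tree with such an ordering is the same as a plane tree with [n] vertices
      together with the list of its labels in preorder, which is one of [n!]
      permutations of ['I_n] ([plane_of_perm], [sum_tree_factor]).

    The root is univalent, hence has exactly one child.  The plane tree of a
    rooted tree is thus [Node _ [:: P]], and [P] is a plane tree without unary
    vertices. *)

Set Implicit Arguments.
Unset Strict Implicit.
Unset Printing Implicit Defensive.

Import Order.TTheory GRing.Theory Num.Theory.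
Local Open Scope ring_scope.

(** * Plane trees *)

(* The automatic induction principle says nothing about the subtrees in the
   list; [ptree_ind] below does. *)
Unset Elimination Schemes.
Inductive ptree (T : Type) : Type := Node of T & seq (ptree T).
Set Elimination Schemes.

Section PlaneTreeEq.
Variable T : Type.

Fixpoint gentree_of (L : ptree T) : GenTree.tree T :=
  let: Node x s := L in GenTree.Node 0 (GenTree.Leaf x :: map gentree_of s).

Fixpoint of_gentree (g : GenTree.tree T) : option (ptree T) :=
  if g is GenTree.Node _ (GenTree.Leaf x :: s)
  then Some (Node x (pmap of_gentree s)) else None.

Lemma gentree_ofK : pcancel gentree_of of_gentree.
Proof.
suff : forall L, of_gentree (gentree_of L) = Some L by [].
fix IH 1 => -[x s] /=; congr (Some (Node x _)).
by elim: s => //= L s IHs; rewrite IH /= IHs.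
Qed.

End PlaneTreeEq.

HB.instance Definition _ (T : eqType) :=
  Equality.copy (ptree T) (pcan_type (@gentree_ofK T)).

Lemma ptree_ind (T : eqType) (Q : ptree T -> Prop) :
  (forall x s, {in s, forall L, Q L} -> Q (Node x s)) -> forall L, Q L.
Proof.
move=> Qnode; fix IH 1 => -[x s]; apply: Qnode.
(* The base case must not be closed with [IH], which the guard condition allows
   for subtrees only. *)
elim: s => [M|L s IHs M]; first by rewrite in_nil; discriminate.
by rewrite inE => /predU1P[->|/IHs].
Qed.

Section PlaneTrees.
Variable T : eqType.
Implicit Types (L M : ptree T) (s : seq (ptree T)).

Definition label L := let: Node x _ := L in x.
Definition kids L := let: Node _ s := L in s.

Fixpoint subtrees L := let: Node _ s := L in L :: flatten (map subtrees s).

Definition labels L := map label (subtrees L).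
Definition leaf_count L := count (fun M => nilp (kids M)) (subtrees L).

Definition unary_free L := all (fun M => size (kids M) != 1%N) (subtrees L).

Lemma subtreesE L : subtrees L = L :: flatten (map subtrees (kids L)).
Proof. by case: L. Qed.

Lemma subtrees_id L : L \in subtrees L.
Proof. by rewrite subtreesE mem_head. Qed.

Lemma subtreesP M L :
  reflect (M = L \/ exists2 K, K \in kids L & M \in subtrees K) (M \in subtrees L).
Proof.
rewrite subtreesE inE; apply: (iffP predU1P) => -[->|]; try by left.
  by case/flatten_mapP=> K; right; exists K.
by case=> K *; right; apply/flatten_mapP; exists K.
Qed.

Lemma subtrees_trans M L K :
  K \in subtrees M -> M \in subtrees L -> K \in subtrees L.
Proof.
move=> KM; elim/ptree_ind: L => x s IH /subtreesP[<- //|[N Ns MN]].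
by apply/subtreesP; right; exists N => //; apply: IH.
Qed.

Lemma mem_kids_subtrees M L : M \in kids L -> M \in subtrees L.
Proof. by move=> ML; apply/subtreesP; right; exists M; rewrite ?subtrees_id. Qed.

Lemma labelsE L : labels L = label L :: flatten (map labels (kids L)).
Proof. by rewrite /labels subtreesE /= map_flatten -map_comp. Qed.

Lemma size_labels L : size (labels L) = size (subtrees L).
Proof. exact: size_map. Qed.

Lemma size_subtrees L :
  size (subtrees L) = (sumn [seq size (subtrees M) | M <- kids L]).+1.
Proof. by rewrite subtreesE /= size_flatten /shape -map_comp. Qed.

Lemma leaf_countE L :
  leaf_count L = if nilp (kids L) then 1%N else sumn (map leaf_count (kids L)).
Proof.
rewrite /leaf_count subtreesE /= count_flatten -map_comp.
by case: (kids L).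
Qed.

Lemma leaf_count_gt0 L : (0 < leaf_count L)%N.
Proof.
elim/ptree_ind: L => x [|L s] IH; rewrite leaf_countE //=.
by rewrite addn_gt0 IH ?mem_head.
Qed.

Lemma unary_freeE L :
  unary_free L = (size (kids L) != 1%N) && all unary_free (kids L).
Proof.
rewrite /unary_free subtreesE /=; congr (_ && _).
by elim: (kids L) => //= M s IHs; rewrite all_cat IHs.
Qed.

Lemma size_kids_leaf_count L : (size (kids L) <= leaf_count L)%N.
Proof.
rewrite leaf_countE; case: nilP => [->//|_].
elim: (kids L) => //= M s IHs.
by have := leaf_count_gt0 M; lia.
Qed.

(** Every vertex with two or more children separates leaves, so a tree without
    unary vertices has fewer than twice as many vertices as leaves. *)
Lemma unary_free_size L :
  unary_free L -> (size (subtrees L) < 2 * leaf_count L)%N.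
Proof.
elim/ptree_ind: L => x s IH; rewrite unary_freeE leaf_countE size_subtrees /=.
case: s IH => [|L [|M s]] IH //= /and3P[uL uM us].
have := IH L (mem_head _ _) uL.
have := IH M _ uM; rewrite !inE eqxx orbT => /(_ isT).
set a := sumn [seq size (subtrees i) | i <- s].
set b := sumn [seq leaf_count i | i <- s].
suff : (a <= 2 * b)%N by lia.
rewrite {}/a {}/b.
have {}IH : {in s, forall K, unary_free K ->
   (size (subtrees K) < 2 * leaf_count K)%N}.
  by move=> K Ks; apply: IH; rewrite !inE Ks !orbT.
elim: s us IH => //= K s IHs /andP[uK us] IH.
have := IH K (mem_head _ _) uK.
have : {in s, forall K, unary_free K -> (size (subtrees K) < 2 * leaf_count K)%N}.
  by move=> N Ns; apply: IH; rewrite inE Ns orbT.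
move/(IHs us); set a := sumn _; set b := sumn _; lia.
Qed.

Lemma unary_free_leaf L : unary_free L -> leaf_count L = 1%N -> kids L = [::].
Proof.
rewrite unary_freeE leaf_countE; case: (kids L) => [//|M [|N s]] //= _.
by have := leaf_count_gt0 M; have := leaf_count_gt0 N; lia.
Qed.

End PlaneTrees.

Fixpoint erase (T : Type) (L : ptree T) : ptree unit :=
  let: Node _ s := L in Node tt (map (@erase T) s).

Section Erase.
Variable T : eqType.
Implicit Types (L M : ptree T) (s : seq (ptree T)).

Lemma kids_erase L : kids (erase L) = map (@erase T) (kids L).
Proof. by case: L. Qed.

Lemma subtrees_erase L : subtrees (erase L) = map (@erase T) (subtrees L).
Proof.
elim/ptree_ind: L => x s IH /=; congr (_ :: _).
rewrite map_flatten -!map_comp; congr flatten.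
by apply/eq_in_map => M Ms; rewrite /= IH.
Qed.

Lemma leaf_count_erase L : leaf_count (erase L) = leaf_count L.
Proof.
rewrite /leaf_count subtrees_erase count_map; apply: eq_count => M /=.
by rewrite kids_erase /nilp size_map.
Qed.

Lemma unary_free_erase L : unary_free (erase L) = unary_free L.
Proof.
rewrite /unary_free subtrees_erase all_map; apply: eq_all => M /=.
by rewrite kids_erase size_map.
Qed.

(** The labels of the child subtrees sit in consecutive blocks of the preorder
    label list, of lengths prescribed by the shape. *)
Lemma erase_labels_inj L M : erase L = erase M -> labels L = labels M -> L = M.
Proof.
elim/ptree_ind: L M => x s IH [y t] [] est; rewrite !labelsE /= => -[-> ef].
congr Node; have [sz nthE] : map (@size T) (map (@labels T) s) =
    map (@size T) (map (@labels T) t) /\ size s = size t.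
  split; last by have := congr1 size est; rewrite !size_map.
  suff h r : map (@size T) (map (@labels T) r) =
    map (fun P => size (subtrees P)) (map (@erase T) r) by rewrite !h est.
  rewrite -!map_comp; apply: eq_map => K /=.
  by rewrite size_labels subtrees_erase size_map.
have {}ef := eq_from_flatten_shape ef sz.
elim: s t IH est ef {sz} nthE => [|L s IHs] [|M t] //= IH [eL es] [lL ls] [sz].
congr (_ :: _); first by apply: IH; rewrite ?mem_head.
by apply: IHs => // K Ks; apply: IH; rewrite inE Ks orbT.
Qed.

(** The list is cut into the label of the root and one block for each child
    subtree. *)
Lemma labelling_exists (P : ptree unit) (l : seq T) :
  size l = size (subtrees P) -> exists L, erase L = P /\ labels L = l.
Proof.
elim/ptree_ind: P l => -[] s IH [|x l]; rewrite size_subtrees //= => -[sz].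
suff [r [<- fr]] : exists r, map (@erase T) r = s /\ flatten (map (@labels T) r) = l.
  by exists (Node x r); rewrite labelsE /= fr.
elim: s l IH sz => [|P s IHs] l IH /=; first by move=> /size0nil->; exists [::].
move=> sz; set p := size (subtrees P) in sz.
have [|L [eL lL]] := IH P (mem_head _ _) (take p l).
  by rewrite size_take sz; case: ltnP => //; lia.
have [||r [er fr]] := IHs (drop p l); first by move=> K Ks; apply: IH; rewrite inE Ks orbT.
  by rewrite size_drop sz; lia.
by exists (L :: r); rewrite /= eL er lL fr cat_take_drop.
Qed.

End Erase.

(** * Listing the plane trees with a given number of leaves *)

Section ListProducts.
Variable S : eqType.

Fixpoint seqprod (ls : seq (seq S)) : seq (seq S) :=
  if ls is l :: ls' then [seq x :: s | x <- l, s <- seqprod ls'] else [:: [::]].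

Lemma mem_seqprod ls s :
  (s \in seqprod ls) = all2 (fun x l => x \in l) s ls.
Proof.
elim: ls s => [|l ls IH] [|x s] //=.
  by apply/negbTE/negP => /allpairsP[[y t] [_ _]].
rewrite -IH; apply/allpairsP/andP => [[[y t] [/= yl tls [-> ->]]] //|[xl sls]].
by exists (x, s).
Qed.

Lemma seqprod_uniq ls : all uniq ls -> uniq (seqprod ls).
Proof.
elim: ls => //= l ls IH /andP[ul /IH uls].
by apply: allpairs_uniq => // -[x s] [y t] _ _ /= [-> ->].
Qed.

Lemma sum_seqprod (g : S -> rat) ls :
  \sum_(s <- seqprod ls) \prod_(x <- s) g x = \prod_(l <- ls) \sum_(x <- l) g x.
Proof.
elim: ls => [|l ls IH] /=; first by rewrite big_seq1 !big_nil.
rewrite big_allpairs_dep big_cons mulr_suml; apply: eq_bigr => x _.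
by rewrite -IH mulr_sumr; apply: eq_bigr => s _; rewrite big_cons.
Qed.

(** The blocks are disjoint because [key] recovers the index of its block from
    any entry. *)
Lemma uniq_flatten_map (I : eqType) (key : S -> I) (F : I -> seq S) (r : seq I) :
  uniq r -> {in r, forall i, uniq (F i)} ->
  {in r, forall i, {in F i, forall y, key y = i}} ->
  uniq (flatten (map F r)).
Proof.
elim: r => //= i r IH /andP[inr ur] uF keyF.
rewrite cat_uniq uF ?mem_head // IH //=; last 2 first.
- by move=> j jr; apply: uF; rewrite inE jr orbT.
- by move=> j jr; apply: keyF; rewrite inE jr orbT.
rewrite andbT; apply/hasPn => y /flatten_mapP[j jr yj]; apply/negP => yi.
move: inr; rewrite -(keyF i (mem_head _ _) y yi) (keyF j _ y yj) ?jr //.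
by rewrite inE jr orbT.
Qed.

End ListProducts.

Definition composition (d k : nat) : pred {ffun 'I_k -> 'I_d.+1} :=
  fun c => [forall i, (0 < c i)%N] && (\sum_(i < k) c i == d)%N.

Section Forests.
Variable E : nat -> seq (ptree unit).

(** Here [E m] is meant to list the available trees with [m] leaves; then these
    are the sequences of [k] available trees that have [d] leaves in all. *)
Definition forests (d k : nat) : seq (seq (ptree unit)) :=
  flatten [seq seqprod [seq E (c i) | i <- enum 'I_k] |
           c : {ffun 'I_k -> 'I_d.+1} <- enum (@composition d k)].

Hypothesis E_leaf_count : forall m, {in E m, forall P, leaf_count P = m}.
Hypothesis E_uniq : forall m, uniq (E m).

Let tree0 : ptree unit := Node tt [::].

Lemma seqprod_enumP (k : nat) (F : 'I_k -> seq (ptree unit)) s :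
  reflect (size s = k /\ forall i : 'I_k, nth tree0 s i \in F i)
          (s \in seqprod [seq F i | i <- enum 'I_k]).
Proof.
have szF : size [seq F i | i <- enum 'I_k] = k by rewrite size_map size_enum_ord.
rewrite mem_seqprod all2E szF.
apply: (iffP andP) => [[/eqP sz /all_nthP al]|[sz al]]; split=> //; rewrite ?sz //.
  move=> i; have := al (tree0, [::]) i; rewrite size_zip szF sz minnn nth_zip ?szF //=.
  by rewrite (nth_map i) ?size_enum_ord // nth_ord_enum; apply.
apply/(all_nthP (tree0, [::])) => i; rewrite size_zip szF sz minnn => ik.
rewrite nth_zip ?szF //= (nth_map (Ordinal ik)) ?size_enum_ord //.
by rewrite (nth_ord_enum (Ordinal ik) (Ordinal ik)); apply: (al (Ordinal ik)).
Qed.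

Lemma sumn_nth_ord (s : seq nat) : sumn s = (\sum_(i < size s) nth 0 s i)%N.
Proof. by rewrite sumnE (big_nth 0%N) big_mkord. Qed.

Lemma mem_forests d k s : s \in forests d k ->
  [/\ size s = k, sumn (map (@leaf_count _) s) = d &
      {in s, forall P, exists2 m, (0 < m)%N & P \in E m}].
Proof.
case/flatten_mapP => c; rewrite mem_enum => /andP[/forallP c0 /eqP cd].
case/seqprod_enumP => sz inE; split=> // [|P].
  rewrite sumn_nth_ord size_map sz -[RHS]cd; apply: eq_bigr => i _.
  by rewrite (nth_map tree0) ?sz // (E_leaf_count (inE i)).
move=> /(nthP tree0)[i]; rewrite sz => ik <-.
by exists (c (Ordinal ik)) => //; apply: (inE (Ordinal ik)).
Qed.

Lemma in_forests d s : sumn (map (@leaf_count _) s) = d ->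
  {in s, forall P, P \in E (leaf_count P)} -> s \in forests d (size s).
Proof.
move=> sd sE; apply/flatten_mapP.
have lt_d (i : 'I_(size s)) : (leaf_count (nth tree0 s i) < d.+1)%N.
  rewrite ltnS -sd sumn_nth_ord size_map (bigD1 i) //= (nth_map tree0) //.
  exact: leq_addr.
exists [ffun i => Ordinal (lt_d i)].
  rewrite mem_enum; apply/andP; split.
    by apply/forallP => i; rewrite ffunE leaf_count_gt0.
  apply/eqP; rewrite -[RHS]sd sumn_nth_ord size_map; apply: eq_bigr => i _.
  by rewrite ffunE /= (nth_map tree0).
by apply/seqprod_enumP; split=> // i; rewrite ffunE /=; apply/sE/mem_nth.
Qed.

Lemma forests_uniq d k : uniq (forests d k).
Proof.
pose key s := [ffun i : 'I_k => inord (leaf_count (nth tree0 s i)) : 'I_d.+1].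
apply: (uniq_flatten_map (key := key)); first exact: enum_uniq.
  by move=> c _; apply: seqprod_uniq; apply/allP => _ /mapP[i _ ->].
move=> c _ s /seqprod_enumP[sz sE]; apply/ffunP => i.
by rewrite ffunE (E_leaf_count (sE i)) inord_val.
Qed.

Lemma sum_forests (g : ptree unit -> rat) d k :
  \sum_(s <- forests d k) \prod_(P <- s) g P =
  \sum_(c | @composition d k c) \prod_(i < k) \sum_(P <- E (c i)) g P.
Proof.
rewrite big_flatten big_map big_enum /=; apply: eq_bigr => c _.
by rewrite sum_seqprod big_map big_enum.
Qed.

End Forests.

(** The fuel [f] bounds the height.  A child of a vertex with at least two
    children has fewer leaves than the vertex, so [d <= f] is enough for all
    trees with [d] leaves and no unary vertex to be found. *)
Fixpoint plane_trees (f d : nat) : seq (ptree unit) :=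
  if f is f'.+1 then
    if d == 1%N then [:: Node tt [::]] else
    flatten [seq map (Node tt) (forests (plane_trees f') d k) | k <- index_iota 2 d.+1]
  else [::].

Lemma plane_treesS f d : d != 1%N ->
  plane_trees f.+1 d =
    flatten [seq map (Node tt) (forests (plane_trees f) d k) | k <- index_iota 2 d.+1].
Proof. by move=> /negPf /= ->. Qed.

Lemma plane_trees_sound f d :
  {in plane_trees f d, forall P, unary_free P /\ leaf_count P = d}.
Proof.
elim: f d => //= f IH d P; case: eqP => [->|_]; first by rewrite inE => /eqP->.
case/flatten_mapP=> k; rewrite mem_index_iota => /andP[k2 kd] /mapP[s + ->].
case/mem_forests => [m Q /IH[] //|sz sd sE].
rewrite unary_freeE leaf_countE /= sz sd /nilp sz.
case: k k2 {sz kd} => [|[|k]] //= _; split=> //; apply/allP => Q /sE[m _].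
by case/IH.
Qed.

Lemma plane_trees_complete f P :
  unary_free P -> (leaf_count P <= f)%N -> P \in plane_trees f (leaf_count P).
Proof.
elim: f P => [|f IH] P uP; first by rewrite leqNgt leaf_count_gt0.
case: (eqVneq (leaf_count P) 1%N) => [P1 _|P1 Pf] /=; rewrite ?(negPf P1) ?P1 /=.
  by case: P uP P1 => -[] s uP /(unary_free_leaf uP) /= ->.
case: P uP P1 Pf => -[] s uP P1 Pf; apply/flatten_mapP.
move: uP P1 (size_kids_leaf_count (Node tt s)).
rewrite unary_freeE leaf_countE /=; case: nilP => //= s0 /andP[s1 us] P1 sd.
exists (size s).
  by rewrite mem_index_iota ltnS sd andbT; case: s s0 s1 {us P1 sd Pf} => [|? [|? ?]].
apply: map_f; apply: in_forests => // Q Qs; apply: IH; first exact: (allP us).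
move: Pf; rewrite leaf_countE /=; case: nilP => // _.
case/splitPr: Qs s1 {us P1 sd s0} => s1 s2; rewrite map_cat sumn_cat size_cat /=.
case: s1 => [|R s1] /=; last by have := leaf_count_gt0 R; lia.
by case: s2 => [|R s2] //=; have := leaf_count_gt0 R; lia.
Qed.

Lemma mem_plane_trees f d P : (d <= f)%N ->
  (P \in plane_trees f d) = unary_free P && (leaf_count P == d).
Proof.
move=> df; apply/idP/andP => [/plane_trees_sound[-> ->] //|[uP /eqP Pd]].
by rewrite -Pd plane_trees_complete // Pd.
Qed.

Lemma plane_trees_uniq f d : uniq (plane_trees f d).
Proof.
elim: f d => //= f IH d; case: eqP => // _.
have lc m : {in plane_trees f m, forall P, leaf_count P = m}.
  by move=> P /plane_trees_sound[].
apply: (uniq_flatten_map (key := fun P => size (kids P))); first exact: iota_uniq.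
  move=> k _; rewrite map_inj_uniq; first exact: forests_uniq.
  by move=> s t [].
by move=> k _ _ /mapP[s /(mem_forests lc)[sz _ _] ->].
Qed.

(** * The recursion as a sum over plane trees *)

(** The contribution of a vertex with [k] children and [m] leaves above it; the
    [k`!] accounts for the orderings of the children.  In a tree without unary
    vertices [k = m] holds at a vertex exactly when all its children are leaves,
    that is when it is movable.  Leaves, and the root with its single child,
    contribute [1]. *)
Definition vertex_factor (k m : nat) : rat :=
  if (k < 2)%N then 1 else
  ((3 * m - 1)`!)%:R / ((k`!)%:R * ((3 * m - k)`!)%:R) *
  (if k == m then 2 ^- m * 'C(2 * m, m)%:R - 1 else -1).

Definition plane_weight (T : eqType) (L : ptree T) : rat :=
  \prod_(M <- subtrees L) vertex_factor (size (kids M)) (leaf_count M).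

Lemma plane_weightE (T : eqType) (L : ptree T) :
  plane_weight L =
    vertex_factor (size (kids L)) (leaf_count L) * \prod_(M <- kids L) plane_weight M.
Proof. by rewrite /plane_weight subtreesE big_cons big_flatten big_map. Qed.

Lemma plane_weight_erase (T : eqType) (L : ptree T) :
  plane_weight (erase L) = plane_weight L.
Proof.
rewrite /plane_weight subtrees_erase big_map; apply: eq_bigr => M _.
by rewrite kids_erase size_map leaf_count_erase.
Qed.

Definition plane_sum (d : nat) : rat := \sum_(P <- plane_trees d d) plane_weight P.

Lemma plane_sum_fuel f d : (d <= f)%N ->
  \sum_(P <- plane_trees f d) plane_weight P = plane_sum d.
Proof.
move=> df; apply/perm_big/uniq_perm; rewrite ?plane_trees_uniq //.
by move=> P; rewrite !mem_plane_trees.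
Qed.

Lemma composition_lt d k (c : {ffun 'I_k -> 'I_d.+1}) i :
  (1 < k)%N -> composition c -> (c i < d)%N.
Proof.
move=> k1 /andP[/forallP c0 /eqP cd]; rewrite -[X in (_ < X)%N]cd.
have [j ji] : exists j, j != i.
  case: k k1 c i {c0 cd} => [|[|k]] // _ _ i.
  by case: (eqVneq i ord0) => [->|i0]; [exists ord_max | exists ord0; rewrite eq_sym].
rewrite (bigD1 i) //= (bigD1 j) //=.
by have := c0 j; lia.
Qed.

Lemma plane_sum1 : plane_sum 1 = 1.
Proof. by rewrite /plane_sum /= big_seq1 plane_weightE /= /vertex_factor big_nil mulr1. Qed.

(** A plane tree that is not a single leaf is the sequence of the subtrees at the
    children of its bottom vertex. *)
Lemma plane_sum_rec d : (1 < d)%N ->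
  plane_sum d = \sum_(2 <= k < d.+1) vertex_factor k d *
    \sum_(c | @composition d k c) \prod_(i < k) plane_sum (c i).
Proof.
case: d => [|[|d]] // _; rewrite /plane_sum plane_treesS // big_flatten big_map.
rewrite big_seq_cond [RHS]big_seq_cond; apply: eq_bigr => k.
rewrite andbT mem_index_iota => /andP[k2 _]; rewrite big_map.
have lc m : {in plane_trees d.+1 m, forall P, leaf_count P = m}.
  by move=> P /plane_trees_sound[].
transitivity (\sum_(s <- forests (plane_trees d.+1) d.+2 k)
   vertex_factor k d.+2 * \prod_(P <- s) plane_weight P).
  rewrite big_seq_cond [RHS]big_seq_cond; apply: eq_bigr => s.
  rewrite andbT => /(mem_forests lc)[sz sd _]; rewrite plane_weightE /= sz.
  by rewrite leaf_countE /= sd /nilp sz; case: k k2 {sz}.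
rewrite -mulr_sumr sum_forests; congr (_ * _); apply: eq_bigr => c cc.
apply: eq_bigr => i _; apply: plane_sum_fuel.
by rewrite -ltnS (composition_lt i k2 cc).
Qed.

(** Positive parts, as many as their sum, are all equal to [1]. *)
Lemma sum_composition_ones (F : nat -> rat) d : F 1%N = 1 ->
  \sum_(c | @composition d d c) \prod_(i < d) F (c i) = 1.
Proof.
case: d => [|d] F1.
  rewrite (big_pred1 [ffun=> ord0]) ?big_ord0 // => c /=.
  rewrite /composition big_ord0 eqxx andbT.
  have -> : c == [ffun=> ord0] by apply/eqP/ffunP => -[].
  by apply/forallP => -[].
rewrite (big_pred1 [ffun=> inord 1]); first last.
  move=> c /=; apply/andP/eqP => [[/forallP c0 /eqP cd]|->].
    apply/ffunP => i; apply/val_inj; rewrite ffunE /= inordK //.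
    have h j : (1 <= c j)%N by [].
    move: cd; rewrite (bigD1 i) //=; set S := (\sum_(j < d.+1 | _) _)%N.
    have dS : (d <= S)%N.
      rewrite -[X in (X <= _)%N](_ : \sum_(j < d.+1 | j != i) 1 = d)%N ?leq_sum //.
      by rewrite sum1_card cardC1 card_ord.
    by move: (nat_of_ord (c i)) (h i) => ci; lia.
  split; first by apply/forallP => i; rewrite ffunE inordK.
  by under eq_bigr do rewrite ffunE inordK //; rewrite sum1_card card_ord.
by apply: big1 => i _; rewrite ffunE inordK.
Qed.

(** Both sides satisfy the same recursion.  The powers of [2] factor out since
    the parts of a composition add up to [d]; for [k = d] the sum over
    compositions is [1], and the constant term [(3 d - 1)! / d!^3] is what the
    factor of a movable vertex has besides the [-1] of the other vertices. *)
Lemma tildeT_plane_sum T d : superpotential_recursion T -> (0 < d)%N ->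
  tildeT T d = 2 ^+ d * plane_sum d.
Proof.
move=> hT; elim/ltn_ind: d => d IH d0; rewrite hT //.
have [d1|d2] := leqP d 1.
  have -> : d = 1%N by lia.
  by rewrite big_nil plane_sum1 /= subr0 expr1n invr1 mulr1.
rewrite plane_sum_rec //.
have comp k (c : {ffun 'I_k -> 'I_d.+1}) : (1 < k)%N -> composition c ->
    \prod_(i < k) tildeT T (c i) = 2 ^+ d * \prod_(i < k) plane_sum (c i).
  move=> k1 cc; have /andP[/forallP c0 /eqP cd] := cc.
  rewrite -[X in 2 ^+ X]cd expr_sum -big_split; apply: eq_bigr => i _ /=.
  by rewrite IH ?c0 // (composition_lt i k1 cc).
(* The sum over compositions that multiplies the coefficient for [k]. *)
pose E k := \sum_(c | @composition d k c) \prod_(i < k) plane_sum (c i).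
have -> : \sum_(2 <= k < d.+1) \sum_(c : {ffun 'I_k -> 'I_d.+1} |
     [forall i, (0 < c i)%N] && (\sum_(i < k) c i == d)%N)
         (\prod_(i < k) tildeT T (c i)) / ((k`!)%:R * ((3 * d - k)`!)%:R) =
   \sum_(2 <= k < d.+1) 2 ^+ d * E k / ((k`!)%:R * ((3 * d - k)`!)%:R).
  apply: eq_big_nat => k /andP[k2 _]; rewrite mulr_sumr mulr_suml.
  by apply: eq_bigr => c cc; rewrite comp.
rewrite !big_nat_recr //= -/(E d).
have -> : \sum_(2 <= k < d) vertex_factor k d * E k =
  - ((3 * d - 1)`!)%:R * \sum_(2 <= k < d) E k / ((k`!)%:R * ((3 * d - k)`!)%:R).
  rewrite mulr_sumr; apply: eq_big_nat => k /andP[k2 kd].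
  by rewrite /vertex_factor ltnNge k2 /= ltn_eqF //; ring.
have Ed : E d = 1 by rewrite /E sum_composition_ones ?plane_sum1.
rewrite Ed /vertex_factor ltnNge d2 /= eqxx.
under eq_bigr => k _ do rewrite -mulrA.
rewrite -mulr_sumr; set S := \sum_(_ <= _ < _) _.
have bf : ('C(2 * d, d)%:R : rat) = ((2 * d)`!)%:R / ((d`!)%:R * (d`!)%:R).
  rewrite -(@bin_fact (2 * d) d) ?leq_pmull // !natrM.
  have -> : (2 * d - d = d)%N by lia.
  by rewrite mulfK // mulf_neq0 // pnatr_eq0 -lt0n fact_gt0.
rewrite bf (_ : 3 * d - d = 2 * d)%N; last by lia.
have f1 : ((d`!)%:R : rat) != 0 by rewrite pnatr_eq0 -lt0n fact_gt0.
have f2 : (((2 * d)`!)%:R : rat) != 0 by rewrite pnatr_eq0 -lt0n fact_gt0.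
have f3 : (2 ^+ d : rat) != 0 by rewrite expf_neq0.
set a := (d`!)%:R in f1 *; set b := ((2 * d)`!)%:R in f2 *.
set p := 2 ^+ d in f3 *; rewrite -exprVn.
by move: ((3 * d - 1)`!)%:R => x; field; rewrite f1 f2 f3.
Qed.

(** * Rooted trees given by a parent map *)

Section RootedTrees.
Variable n : nat.
Implicit Types (t : rtree n) (u v w c : 'I_n).

Definition children t v : {set 'I_n} := [set u | (u != troot t) && (parent t u == v)].
Definition depth t v : nat := findex (parent t) v (troot t).

Section Facts.
Variables (t : rtree n) (ht : is_rtree t).

Lemma parent_root : parent t (troot t) = troot t.
Proof. by case/andP: ht => /eqP. Qed.

Lemma above_root v : above t v (troot t).
Proof. by case/andP: ht => _ /forallP. Qed.

Lemma above_refl v : above t v v.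
Proof. exact: connect0. Qed.

Lemma above_parent v w : above t (parent t v) w -> above t v w.
Proof. exact/connect_trans/fconnect1. Qed.

Lemma aboveE v w : above t v w = (v == w) || above t (parent t v) w.
Proof. exact: fconnect_eqVf. Qed.

Lemma depth_parent v : v != troot t -> depth t v = (depth t (parent t v)).+1.
Proof. by move=> vr; apply: fconnect_findex; [apply: above_root | rewrite eq_sym]. Qed.

Lemma depth_lt v : (depth t v < n)%N.
Proof.
apply: leq_trans (findex_max (above_root v)) _.
by rewrite -[X in (_ <= X)%N](card_ord n); apply: max_card.
Qed.

(** The truncated subtraction is right: past the root, the iterates stay there. *)
Lemma depth_iter i v : depth t (iter i (parent t) v) = (depth t v - i)%N.
Proof.
elim: i => [|i IH]; rewrite ?subn0 //= subnS -IH.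
set w := iter _ _ _; case: (eqVneq w (troot t)) => [->|/depth_parent->] //.
by rewrite parent_root /depth findex0.
Qed.

Lemma above_depth u v : above t u v -> (depth t v <= depth t u)%N.
Proof. by move/iter_findex <-; rewrite depth_iter leq_subr. Qed.

(** The path from [u] to the root meets each depth once. *)
Lemma above_iter u v : above t u v -> v != troot t ->
  v = iter (depth t u - depth t v) (parent t) u.
Proof.
move=> uv vr; have := depth_iter (findex (parent t) u v) u.
rewrite iter_findex // => dv; rewrite -{1}(iter_findex uv); congr iter.
by have := depth_parent vr; lia.
Qed.

Lemma childP v c : c \in children t v -> [/\ c != troot t, parent t c = v &
  depth t c = (depth t v).+1].
Proof. by rewrite inE => /andP[cr /eqP <-]; split=> //; apply: depth_parent. Qed.

(** Depth is bounded by [n] and grows from a vertex to its children. *)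
Lemma children_ind (Q : 'I_n -> Prop) :
  (forall v, {in children t v, forall c, Q c} -> Q v) -> forall v, Q v.
Proof.
move=> Qv v; have [m] := ubnP (n - depth t v)%N.
elim: m v => // m IH v dv; apply: Qv => c /childP[_ _ dc]; apply: IH.
by have := depth_lt c; lia.
Qed.

(** The child is the last vertex before [v] on the path from [u]. *)
Lemma above_child u v : above t u v -> u != v ->
  exists2 c, c \in children t v & above t u c.
Proof.
have [m] := ubnP (depth t u); elim: m u => // m IH u du uv neq_uv.
have ur : u != troot t.
  apply: contraNneq neq_uv => ur; have := iter_findex uv; rewrite ur.
  by elim: (findex _ _ _) => [/= -> //|i IHi]; rewrite iterSr parent_root.
move: uv; rewrite aboveE (negPf neq_uv) /= => uv.
case: (eqVneq (parent t u) v) => [puv|npuv].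
  by exists u; rewrite ?above_refl // inE ur puv eqxx.
have [|c cv uc] := IH (parent t u) _ uv npuv.
  by have := depth_parent ur; lia.
by exists c => //; apply: above_parent.
Qed.

(** Two children of [v] have the same depth, so [u] is above at most one. *)
Lemma above_sum_children u v :
  above t u v = ((u == v) + \sum_(c in children t v) above t u c)%N :> nat.
Proof.
have up c : c \in children t v -> above t u c -> above t u v.
  by case/childP => _ <- _ /connect_trans; apply; apply: fconnect1.
case: (boolP (above t u v)) => [uv|nuv]; last first.
  rewrite big1 => [|c cv].
    by case: eqVneq nuv => // ->; rewrite above_refl.
  by case: (boolP (above t u c)) => // /(up c cv); rewrite (negPf nuv).
case: (eqVneq u v) => [->|neq_uv].
  rewrite big1 // => c /childP[_ _ dc]; case: (boolP (above t v c)) => // /above_depth.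
  by rewrite dc ltnn.
have [c cv uc] := above_child uv neq_uv; rewrite (bigD1 c) //= uc big1 // => c' /andP[c'v].
case: (boolP (above t u c')) => // uc' /eqP[].
have [[cr _ dc] [cr' _ dc']] := (childP cv, childP c'v).
by rewrite (above_iter uc cr) (above_iter uc' cr') dc dc'.
Qed.

Lemma valencyE v : valency t v = (#|children t v| + (v != troot t))%N.
Proof.
rewrite /valency; case: (eqVneq v (troot t)) => [->|vr] /=.
  rewrite addn0; apply: eq_card => w; rewrite !inE /adj parent_root eq_sym.
  by case: eqP.
have -> : [set w | adj t v w] = parent t v |: children t v.
  apply/setP => w; rewrite !inE /adj (eq_sym (parent t v)).
  case: (eqVneq w (parent t v)) => [->|_] /=.
    rewrite andbT; apply: contra_eq_neq (depth_parent vr) => <-.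
    by rewrite neq_ltn ltnSn.
  rewrite andbC; case: (eqVneq (parent t w) v) => [pw|_]; rewrite ?andbF //= andbT.
  case: (eqVneq w (troot t)) pw => [->|wr].
    by rewrite parent_root eq_sym => ->; rewrite eqxx.
  move=> pw; have := depth_parent wr; rewrite pw => dw.
  by apply: contra_eq_neq dw => ->; rewrite neq_ltn ltnSn.
rewrite cardsU1 addnC; congr (_ + _)%N; case: (boolP (_ \in _)) => //.
by case/childP => _ _; rewrite (depth_parent vr); lia.
Qed.

End Facts.

(** When [o v] lists the children of [v], this is the plane tree at [v], cut off
    at height [f]. *)
Fixpoint build (o : 'I_n -> seq 'I_n) (f : nat) v : ptree 'I_n :=
  Node v (if f is f'.+1 then map (build o f') (o v) else [::]).

Section Branches.
Variables (t : rtree n) (o : 'I_n -> seq 'I_n).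
Hypotheses (ht : is_rtree t) (ho : forall v, perm_eq (o v) (enum (children t v))).

(** The fuel is chosen so that it drops by one from a vertex to its children and
    is still positive everywhere, since depths are less than [n]. *)
Definition branch v := build o (n - depth t v) v.

Lemma mem_ordering v : o v =i children t v.
Proof. by move=> c; rewrite (perm_mem (ho v)) mem_enum. Qed.

Lemma size_ordering v : size (o v) = #|children t v|.
Proof. by rewrite (perm_size (ho v)) cardE. Qed.

Lemma branchE v : branch v = Node v (map branch (o v)).
Proof.
rewrite {1}/branch; case df: (n - depth t v)%N => [|f] /=.
  by have := depth_lt ht v; lia.
congr Node; apply/eq_in_map => c; rewrite mem_ordering => /(childP ht)[_ _ dc].
by congr build; lia.
Qed.

Lemma branch_root : branch (troot t) = build o n (troot t).
Proof. by rewrite /branch /depth findex0 subn0. Qed.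

Lemma labels_branch v : labels (branch v) = v :: flatten [seq labels (branch c) | c <- o v].
Proof. by rewrite labelsE branchE /= -map_comp. Qed.

Lemma subtrees_branch v : subtrees (branch v) = map branch (labels (branch v)).
Proof.
elim/(children_ind ht): v => v IH; rewrite labels_branch subtreesE /=; congr (_ :: _).
rewrite branchE /= map_flatten -!map_comp; congr flatten; apply/eq_in_map => c /=.
by rewrite mem_ordering => /IH.
Qed.

Lemma count_labels_branch u v : count_mem u (labels (branch v)) = above t u v.
Proof.
elim/(children_ind ht): v => v IH; rewrite labels_branch /= above_sum_children //.
rewrite eq_sym; congr (_ + _)%N; rewrite count_flatten -map_comp sumnE big_map.
rewrite (perm_big _ (ho v)) big_enum /=; exact: eq_bigr.
Qed.

Lemma mem_labels_branch u v : (u \in labels (branch v)) = above t u v.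
Proof. by rewrite -has_pred1 has_count count_labels_branch lt0b. Qed.

Lemma labels_branch_uniq v : uniq (labels (branch v)).
Proof.
by apply: count_mem_uniq => u; rewrite count_labels_branch mem_labels_branch.
Qed.

Lemma perm_labels_root : perm_eq (labels (branch (troot t))) (enum 'I_n).
Proof.
apply: uniq_perm; rewrite ?labels_branch_uniq ?enum_uniq // => u.
by rewrite mem_labels_branch above_root // mem_enum.
Qed.

End Branches.
End RootedTrees.

(** * The weight of a tree in terms of its plane version *)

(** The tree weight without the factor for the automorphisms. *)
Definition tree_factor (n : nat) (t : rtree n) : rat :=
  (-1) ^+ #|Vin t :\: Vmov t| *
  (\prod_(v in Vin t)
     (((3 * leaf_number t v - 1)`!)%:R /
      ((3 * leaf_number t v - valency t v + 1)`!)%:R)) *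
  (\prod_(v in Vmov t)
     (2 ^- leaf_number t v *
      'C(2 * leaf_number t v, leaf_number t v)%:R - 1)).

Section Weights.
Variables (n : nat) (t : rtree n) (o : 'I_n -> seq 'I_n).
Hypotheses (ht : is_rtree t) (ho : forall v, perm_eq (o v) (enum (children t v))).
Implicit Types (u v c : 'I_n) (d : nat).

Local Notation branch := (branch t o).

Lemma kids_branch v : kids (branch v) = map branch (o v).
Proof. by rewrite branchE. Qed.

Lemma size_kids_branch v : size (kids (branch v)) = #|children t v|.
Proof. by rewrite kids_branch size_map (size_ordering ho). Qed.

Lemma mem_leaves v : (v \in leaves t) = (v != troot t) && (#|children t v| == 0)%N.
Proof.
by rewrite inE valencyE //; case: (v != troot t); rewrite // addn1 eqSS.
Qed.

(** The plane tree counts childless vertices; the hypothesis makes sure that the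
    root is not one of them. *)
Lemma leaf_number_branch v : #|children t (troot t)| = 1%N ->
  leaf_number t v = leaf_count (branch v).
Proof.
move=> r1; rewrite /leaf_count subtrees_branch // count_map -size_filter.
rewrite -(card_uniqP (filter_uniq _ (labels_branch_uniq ht ho v))).
apply: eq_card => u; rewrite inE mem_filter mem_labels_branch // mem_leaves /=.
rewrite /nilp size_kids_branch.
by case: (eqVneq u (troot t)) => // ->; rewrite r1.
Qed.

Lemma leaf_number_gt0 v : #|children t (troot t)| = 1%N -> (0 < leaf_number t v)%N.
Proof. by move=> r1; rewrite leaf_number_branch // leaf_count_gt0. Qed.

Section Planted.
Variable c0 : 'I_n.
Hypothesis oroot : o (troot t) = [:: c0].

Lemma card_children_root : #|children t (troot t)| = 1%N.
Proof. by rewrite -(size_ordering ho) oroot. Qed.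

Lemma leaf_count_planted : leaf_count (branch c0) = #|leaves t|.
Proof.
have := leaf_number_branch (troot t) card_children_root.
rewrite leaf_countE kids_branch oroot /= addn0 => <-.
by apply: eq_card => u; rewrite [LHS]inE above_root ?andbT.
Qed.

Lemma mem_labels_planted u : (u \in labels (branch c0)) = (u != troot t).
Proof.
have := perm_labels_root ht ho; rewrite labels_branch // oroot /= cats0 => pl.
have := perm_uniq pl; rewrite enum_uniq /= => /andP[rn _].
have := perm_mem pl u; rewrite mem_enum !inE => /orP[/eqP->|uc].
  by rewrite eqxx (negPf rn).
by rewrite uc; apply/esym; apply: contraNneq rn => <-.
Qed.

Lemma unary_free_planted :
  unary_free (branch c0) = [forall v, valency t v != 2%N].
Proof.
rewrite /unary_free subtrees_branch // all_map.
apply/allP/forallP => [nu v|nv u] /=.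
  rewrite valencyE //; case: (eqVneq v (troot t)) => [->|vr].
    by rewrite card_children_root.
  have := nu v; rewrite mem_labels_planted => /(_ vr) /=.
  by rewrite size_kids_branch addn1 eqSS.
rewrite mem_labels_planted size_kids_branch => ur.
by have := nv u; rewrite valencyE // ur addn1 eqSS.
Qed.

End Planted.

(** A univalent root has one child, and a vertex other than the root is bivalent
    when it has one child. *)
Lemma un_trees_branch d :
  (t \in un_trees n d) <->
  exists P, [/\ erase (branch (troot t)) = Node tt [:: P], unary_free P & leaf_count P = d].
Proof.
rewrite inE ht /= valencyE // eqxx addn0; split.
  rewrite -(size_ordering ho); case oroot : (o _) => [|c [|? ?]] //=.
  case/andP => /eqP cd nu; exists (erase (branch c)).
  rewrite unary_free_erase leaf_count_erase (leaf_count_planted oroot) cd.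
  by rewrite (unary_free_planted oroot) nu branchE // oroot.
case=> P []; rewrite branchE //= -(size_ordering ho).
case oroot : (o _) => [|c [|? ?]] //= [<-].
rewrite unary_free_erase leaf_count_erase (leaf_count_planted oroot).
by rewrite (unary_free_planted oroot) => -> ->; rewrite eqxx.
Qed.

Section UnTree.
Variable d : nat.
Hypothesis td : t \in un_trees n d.

Lemma root_univalent : #|children t (troot t)| = 1%N.
Proof.
by have := td; rewrite inE valencyE // eqxx addn0 => /and3P[_ /eqP].
Qed.

Lemma mem_Vin v : (v \in Vin t) = (1 < #|children t v|)%N.
Proof.
rewrite /Vin !inE -/(troot t) negb_or.
have := td; rewrite inE => /and4P[_ _ _ /forallP/(_ v)].
rewrite valencyE //; case: (eqVneq v (troot t)) => [->|vr] /=.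
  by rewrite root_univalent.
by rewrite addn1; case: #|_| => [|[|k]].
Qed.

Lemma leaf_number_leaf v : v \in leaves t -> leaf_number t v = 1%N.
Proof.
rewrite mem_leaves => /andP[_ /eqP v0]; rewrite leaf_number_branch ?root_univalent //.
by rewrite leaf_countE /nilp size_kids_branch v0.
Qed.

Lemma leaf_number_children v : (0 < #|children t v|)%N ->
  leaf_number t v = (\sum_(c in children t v) leaf_number t c)%N.
Proof.
move=> v0; rewrite leaf_number_branch ?root_univalent // leaf_countE /nilp.
rewrite size_kids_branch -leqn0 leqNgt v0 /= kids_branch -map_comp sumnE big_map.
rewrite (perm_big _ (ho v)) big_enum /=; apply: eq_bigr => c _.
by rewrite leaf_number_branch ?root_univalent.
Qed.

(** A child that is not a leaf has at least two children, hence two leaves. *)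
Lemma child_leaf_number c v : c \in children t v ->
  (1 <= leaf_number t c ?= iff (c \in leaves t))%N.
Proof.
case/(childP ht) => cr _ _; split; first by rewrite leaf_number_gt0 ?root_univalent.
apply/eqP/idP => [c1|/leaf_number_leaf //].
have := size_kids_leaf_count (branch c).
rewrite size_kids_branch -leaf_number_branch ?root_univalent // -c1.
have := td; rewrite inE => /and4P[_ _ _ /forallP/(_ c)].
rewrite mem_leaves cr valencyE // cr.
by case: #|_| => [|[|k]].
Qed.

(** A vertex is movable when all its children are leaves, that is when each of
    them contributes a single leaf to its leaf number. *)
Lemma mem_Vmov v : (v \in Vmov t) =
  (1 < #|children t v|)%N && (#|children t v| == leaf_number t v).
Proof.
rewrite inE mem_Vin; case: ltnP => //= v1; rewrite leaf_number_children; last exact: ltnW.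
have <- : [forall c in children t v, c \in leaves t] =
    (#|children t v| == \sum_(c in children t v) leaf_number t c)%N.
  rewrite -sum1_card; apply/esym.
  by have [_ ->] := leqif_sum (fun c => @child_leaf_number c v).
apply/forall_inP/forall_inP => [mov c cv|lv u uV].
  have [cr pc dc] := childP ht cv; apply: contraT => cl.
  have cV : c \in Vin t by rewrite inE in_setU1 negb_or cr.
  have := mov c cV; rewrite (_ : c != v) /=.
    by rewrite -pc above_parent ?above_refl.
  by apply: contra_eq_neq dc => ->; rewrite neq_ltn ltnSn.
apply/implyP => uv; apply/negP => /(above_child ht)/(_ uv)[c /lv cl uc].
have c0 : children t c = set0.
  by apply/eqP; rewrite -cards_eq0; move: cl; rewrite mem_leaves => /andP[].
case: (eqVneq u c) uV => [->|/(above_child ht uc)[c']].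
  by rewrite mem_Vin c0 cards0.
by rewrite c0 inE.
Qed.

(** The factors agree vertex by vertex: the product of the [k_v!] cancels the
    [k!] in [vertex_factor]. *)
Lemma tree_factor_branch :
  tree_factor t =
  (\prod_v (#|children t v|`!)%:R) * plane_weight (branch (troot t)).
Proof.
rewrite /plane_weight subtrees_branch // big_map (perm_big _ (perm_labels_root ht ho)).
rewrite big_enum /= -big_split /tree_factor -prodr_const.
rewrite [X in X * _ * _]big_mkcond [X in _ * X * _]big_mkcond.
rewrite [X in _ * _ * X = _]big_mkcond -!big_split /=; apply: eq_bigr => v _.
rewrite in_setD mem_Vmov mem_Vin size_kids_branch -leaf_number_branch ?root_univalent //.
rewrite /vertex_factor; case: ltnP => v1 /=; last first.
  by rewrite ltnS v1 !mulr1; case: #|_| v1 => [|[|]].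
rewrite [X in if X then 1 else _]ltnNge v1 /= andbT.
have kl : (#|children t v| <= leaf_number t v)%N.
  by rewrite leaf_number_branch ?root_univalent // -size_kids_branch size_kids_leaf_count.
have vr : v != troot t by apply: contraTneq v1 => ->; rewrite root_univalent.
rewrite valencyE // vr (_ : 3 * _ - _ + 1 = 3 * leaf_number t v - #|children t v|)%N.
  have k0 : (#|children t v|`!%:R : rat) != 0 by rewrite pnatr_eq0 -lt0n fact_gt0.
  have r0 : ((3 * leaf_number t v - #|children t v|)`!%:R : rat) != 0.
    by rewrite pnatr_eq0 -lt0n fact_gt0.
  move: (_ - 1) => m.
  by case: eqP => _ /=; field; rewrite k0 r0.
by lia.
Qed.

End UnTree.
End Weights.

(** * Ordered trees and labelled plane trees *)

Lemma card_perm_eq_bseq (n : nat) (T : finType) (s : seq T) :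
  uniq s -> (size s <= n)%N -> #|[pred b : {bseq n of T} | perm_eq b s]| = (size s)`!.
Proof.
move=> us sn; rewrite -(size_permutations us) cardE -(size_map val).
apply/perm_size/uniq_perm; rewrite ?permutations_uniq //.
  by rewrite map_inj_uniq ?enum_uniq //; apply: val_inj.
move=> l; rewrite mem_permutations; apply/mapP/idP => [[b]|ls].
  by rewrite mem_enum => ? ->.
have ln : (size l <= n)%N by rewrite (perm_size ls).
by exists (Bseq ln); rewrite // mem_enum.
Qed.

(** A list of vertices for each vertex, meant to be the list of its children.
    Bounding the lengths by [n] makes this a finite type. *)
Definition ordering (n : nat) : Type := {ffun 'I_n -> {bseq n of 'I_n}}.

Section Orderings.
Variable n : nat.
Implicit Types (t : rtree n) (o : ordering n).

Definition orderings t : {set ordering n} :=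
  [set o : ordering n | [forall v, perm_eq (o v) (enum (children t v))]].

Lemma card_orderings t : #|orderings t| = (\prod_v #|children t v|`!)%N.
Proof.
pose F v := [pred b : {bseq n of 'I_n} | perm_eq b (enum (children t v))].
have -> : #|orderings t| = #|family F|.
  by apply: eq_card => o; rewrite inE; apply/forallP/familyP => h v; apply: h.
rewrite card_family foldrE big_image; apply: eq_bigr => v _.
rewrite card_perm_eq_bseq ?enum_uniq -?cardE //.
by rewrite -[X in (_ <= X)%N](card_ord n) max_card.
Qed.

Definition plane_of (x : rtree n * ordering n) : ptree 'I_n :=
  build (fun v => x.2 v) n (troot x.1).

Definition ordered_trees (d : nat) : {set rtree n * ordering n} :=
  [set x | (x.1 \in un_trees n d) && (x.2 \in orderings x.1)].

Lemma ordered_treesP d x : x \in ordered_trees d ->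
  [/\ is_rtree x.1, x.1 \in un_trees n d &
      forall v, perm_eq (x.2 v) (enum (children x.1 v))].
Proof.
rewrite inE => /andP[xu]; rewrite inE => /forallP xo; split=> //.
by move: xu; rewrite inE => /andP[].
Qed.

Lemma plane_ofE x : plane_of x = branch x.1 (fun v => x.2 v) (troot x.1).
Proof. by rewrite branch_root. Qed.

(** The subtree with root label [v] is determined by the plane tree, as labels
    are distinct.  Its children give the ordering at [v], and the lists of
    children give the parent map. *)
Lemma plane_of_inj d : {in ordered_trees d &, injective plane_of}.
Proof.
move=> x y /ordered_treesP[hx _ ox] /ordered_treesP[hy _ oy]; rewrite !plane_ofE.
set brx := branch x.1 _; set bry := branch y.1 _ => exy.
have rxy : troot x.1 = troot y.1.
  by have := congr1 (@label _) exy; rewrite /brx /bry !branchE.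
have bE v : brx v = bry v.
  have lx := perm_mem (perm_labels_root hx ox) v; rewrite mem_enum inE in lx.
  have ly := perm_mem (perm_labels_root hy oy) v; rewrite mem_enum inE in ly.
  have ux := labels_branch_uniq hx ox (troot x.1).
  have mx : brx v \in subtrees (brx (troot x.1)) by rewrite subtrees_branch // map_f.
  have my : bry v \in subtrees (brx (troot x.1)).
    by rewrite exy subtrees_branch // map_f.
  (* The two subtrees with root label [v] stand at positions of the same tree
     whose labels are equal, hence at the same position. *)
  have [i ilt xi] := nthP (brx v) mx; have [j jlt yj] := nthP (brx v) my.
  rewrite -xi -yj; congr nth.
  apply/eqP; rewrite -(nth_uniq v _ _ ux) ?size_labels //.
  rewrite /labels !(nth_map (brx v)) // xi yj.
  by rewrite /brx /bry !branchE.
have oE : x.2 = y.2.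
  apply/ffunP => v; apply/val_inj => /=.
  have := congr1 (@kids _) (bE v); rewrite /brx /bry !kids_branch // -/brx -/bry.
  rewrite -(eq_map bE) => /inj_map; apply => u w.
  by move/(congr1 (@label _)); rewrite /brx !branchE.
case: x y => [[r p] o] [[r' p'] o'] /= in hx hy ox oy rxy oE {exy brx bry bE} *.
rewrite /troot /= in rxy; subst r' o'; congr ((_, _), _); apply/ffunP => v.
case: (eqVneq v r) => [->|vr].
  by rewrite [LHS](parent_root hx) [RHS](parent_root hy).
have : v \in o (p v) by rewrite (mem_ordering ox) inE vr eqxx.
by rewrite (mem_ordering oy) inE => /andP[_ /eqP].
Qed.

End Orderings.

(** Conversely, a plane tree whose labels enumerate ['I_n] comes from a rooted
    tree with an ordering. *)
Section Surjectivity.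
Variables (n : nat) (L : ptree 'I_n).
Hypothesis pL : perm_eq (labels L) (enum 'I_n).
Implicit Types (M K : ptree 'I_n) (u v : 'I_n).

Definition kids_at v : seq 'I_n :=
  map (@label _) (kids (nth L (subtrees L) (index v (labels L)))).

(** By default the root, which is no child, becomes its own parent. *)
Definition parent_at v : 'I_n := odflt v [pick u | v \in kids_at u].

Definition rtree_of : rtree n := (label L, [ffun v => parent_at v]).

Definition ordering_of : ordering n := [ffun v => insub_bseq n (kids_at v)].

Lemma kids_at_label M : M \in subtrees L -> kids_at (label M) = map (@label _) (kids M).
Proof.
have uL : uniq (labels L) by rewrite (perm_uniq pL) enum_uniq.
case/(nthP L) => i iL <-; congr (map _ (kids (nth _ _ _))).
have -> : label (nth L (subtrees L) i) = nth (label L) (labels L) i by rewrite (nth_map L).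
by rewrite index_uniq ?size_labels.
Qed.

(** Every subtree but the whole tree is a child of one vertex. *)
Lemma count_labels (T : eqType) (N : ptree T) (a : pred T) :
  count a (labels N) =
    (a (label N) + \sum_(M <- subtrees N) count a (map (@label _) (kids M)))%N.
Proof.
elim/ptree_ind: N => x s IH; rewrite labelsE subtreesE /= big_cons /=; congr (_ + _)%N.
rewrite count_flatten -map_comp sumnE big_map big_flatten big_map /=.
rewrite count_map -sum1_count [X in (_ = X + _)%N]big_mkcond -big_split /=.
rewrite big_seq [RHS]big_seq; apply: eq_bigr => M Ms.
by rewrite IH //; case: (a _).
Qed.

(** In the preorder list of labels each label occurs once, and a label other
    than that of the root stands there as a child. *)
Lemma sum_kids_at v : ((v == label L) + \sum_u count_mem v (kids_at u) = 1)%N.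
Proof.
have <- : count_mem v (labels L) = 1%N.
  by rewrite (seq.permP pL) count_uniq_mem ?enum_uniq // mem_enum.
rewrite count_labels eq_sym; congr (_ + _)%N.
rewrite -big_enum -(perm_big _ pL) big_map /= big_seq [RHS]big_seq.
by apply: eq_bigr => M /kids_at_label->.
Qed.

Lemma kids_at_uniq u : uniq (kids_at u).
Proof.
apply: count_mem_uniq => v; rewrite -has_pred1 has_count.
have : (count_mem v (kids_at u) <= 1)%N.
  by rewrite -(sum_kids_at v) (bigD1 u) //= addnCA leq_addr.
by case: (count_mem _ _) => [|[]].
Qed.

Lemma mem_kids_at u v : (v \in kids_at u) = (v \in children rtree_of u).
Proof.
rewrite inE /parent /troot /= ffunE /parent_at; have := sum_kids_at v.
have cnt w : (v \in kids_at w) = (0 < count_mem v (kids_at w))%N.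
  by rewrite -has_pred1 has_count.
case: eqVneq => [_ /eqP|_ /= e1].
  by rewrite eqSS sum_nat_eq0 => /forallP/(_ u); rewrite cnt /= => /eqP->.
case: pickP => [w vw /=|none]; last first.
  by move: e1; rewrite big1 // => w _; have := none w; rewrite cnt; case: count.
apply/idP/eqP => [vu|<- //]; apply/eqP; apply: contraTT vu => nwu.
move: e1; rewrite (bigD1 w) // (bigD1 u) /=; last by rewrite eq_sym.
move: vw; rewrite !cnt; set a := count_mem v _; set b := count_mem v _.
set r := (\sum_(i < n | _) _)%N.
by rewrite /= in a b *; move: a b r => a b r; lia.
Qed.

Lemma ordering_ofE v : ordering_of v = kids_at v :> seq _.
Proof.
rewrite ffunE; apply: insubdK; rewrite unfold_in /=.
by rewrite -(card_uniqP (kids_at_uniq v)) -[X in (_ <= X)%N](card_ord n) max_card.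
Qed.

Lemma ordering_ofP v : perm_eq (ordering_of v) (enum (children rtree_of v)).
Proof.
rewrite ordering_ofE; apply: uniq_perm; rewrite ?kids_at_uniq ?enum_uniq // => u.
by rewrite mem_enum mem_kids_at.
Qed.

Lemma rtree_ofP : is_rtree rtree_of.
Proof.
apply/andP; split.
  have := sum_kids_at (label L); rewrite eqxx /parent /troot /= ffunE /parent_at => /eqP.
  rewrite eqSS sum_nat_eq0 => /forallP s0; case: pickP => //= u.
  by rewrite -has_pred1 has_count; have := s0 u => /= /eqP->.
apply/forallP => v; have : v \in labels L by rewrite (perm_mem pL) mem_enum.
rewrite /troot /=; case/mapP => K KL ->; move: KL.
move: (subtrees_id L); move: {1 3 4}L => M; elim/ptree_ind: M K => x s IH K ML.
case/subtreesP => [->|[N Ns KN]]; first exact: connect0.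
have NL : N \in subtrees L.
  by apply: subtrees_trans ML; apply: mem_kids_subtrees.
apply: connect_trans (IH N Ns K NL KN) _.
have : label N \in kids_at x by rewrite (kids_at_label ML) map_f.
rewrite mem_kids_at inE => /andP[_ /eqP e].
by have := fconnect1 (parent rtree_of) (label N); rewrite e.
Qed.

Lemma plane_of_rtree_of : plane_of (rtree_of, ordering_of) = L.
Proof.
have szL : size (subtrees L) = n by rewrite -size_labels (perm_size pL) size_enum_ord.
suff rebuild M f : M \in subtrees L -> (size (subtrees M) <= f)%N ->
    build (fun v => ordering_of v) f (label M) = M.
  by apply: rebuild; rewrite ?subtrees_id ?szL.
elim/ptree_ind: M f => x s IH [|f] ML; rewrite size_subtrees //= => sf.
rewrite ordering_ofE (kids_at_label ML) /= -map_comp; congr Node.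
apply: map_id_in => N Ns /=; apply: IH => //.
  by apply: subtrees_trans ML; apply: mem_kids_subtrees.
move: sf; rewrite ltnS; apply: leq_trans.
by case/splitPr: Ns => s1 s2; rewrite map_cat sumn_cat /=; lia.
Qed.

End Surjectivity.

Section CountTrees.
Variables n d : nat.

(** The map to shape and labels is injective by [erase_labels_inj] and
    [plane_of_inj]; a shape with a permutation of the labels is a labelled plane
    tree, which [rtree_of] and [ordering_of] turn into a preimage.  The condition
    on the size leaves one of the [n] vertices for the root. *)
Lemma plane_of_perm :
  perm_eq [seq (erase (plane_of x), labels (plane_of x)) | x <- enum (ordered_trees n d)]
    [seq (Node tt [:: P], l) |
       P <- [seq P <- plane_trees d d | (size (subtrees P)).+1 == n],
       l <- permutations (enum 'I_n)].
Proof.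
apply: uniq_perm.
- rewrite map_inj_in_uniq ?enum_uniq // => x y; rewrite !mem_enum => hx hy [es ls].
  exact: plane_of_inj hx hy (erase_labels_inj es ls).
- apply: allpairs_uniq; rewrite ?filter_uniq ?plane_trees_uniq ?permutations_uniq //.
  by move=> [P l] [Q m] _ _ [-> ->].
case=> Q l; apply/mapP/allpairsP => [[x]|[[P m] /= [+ + [-> ->]]]].
  rewrite mem_enum => /ordered_treesP[hx xu ox] [-> ->].
  have pl := perm_labels_root hx ox; rewrite -plane_ofE in pl.
  have [P [eP uP Pd]] := (un_trees_branch hx ox d).1 xu; rewrite -plane_ofE in eP.
  exists (P, labels (plane_of x)) => /=; split=> //; last by rewrite eP.
    rewrite mem_filter mem_plane_trees // uP Pd eqxx /= andbT.
    have := perm_size pl; rewrite size_enum_ord size_labels => <-.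
    have := congr1 (fun Q => size (subtrees Q)) eP.
    by rewrite subtrees_erase size_map /= cats0 => ->.
  by rewrite mem_permutations.
rewrite mem_filter mem_plane_trees // mem_permutations => /and3P[/eqP szP uP /eqP Pd] pm.
have [|L [eL lL]] := @labelling_exists 'I_n (Node tt [:: P]) m.
  by rewrite (perm_size pm) size_enum_ord -szP /= cats0.
have pL : perm_eq (labels L) (enum 'I_n) by rewrite lL.
exists (rtree_of L, ordering_of L); last by rewrite plane_of_rtree_of // eL lL.
rewrite mem_enum inE /=; apply/andP; split; last first.
  by rewrite inE; apply/forallP; apply: ordering_ofP.
apply/(un_trees_branch (rtree_ofP pL) (ordering_ofP pL)); exists P; split=> //.
by rewrite -(plane_ofE (rtree_of L, ordering_of L)) plane_of_rtree_of.
Qed.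

(** Each tree is counted once for each of its [prod_v k_v!] orderings, with its
    weight divided by that number, which is the weight of its plane tree. *)
Lemma sum_tree_factor :
  \sum_(t in un_trees n d) tree_factor t =
  (n`!)%:R * \sum_(P <- plane_trees d d | (size (subtrees P)).+1 == n) plane_weight P.
Proof.
transitivity (\sum_(x in ordered_trees n d) plane_weight (erase (plane_of x))).
  rewrite [RHS](eq_bigl (fun x =>
    (x.1 \in un_trees n d) && (x.2 \in orderings x.1))); last first.
    by move=> x; rewrite inE.
  rewrite -(pair_big_dep (mem (un_trees n d)) (fun t o => o \in orderings t)
     (fun t o => plane_weight (erase (plane_of (t, o))))) /=.
  apply: eq_bigr => t tu; have ht : is_rtree t by move: tu; rewrite inE => /andP[].
  transitivity (\sum_(o in orderings t) tree_factor t / (\prod_v (#|children t v|`!)%:R)).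
    rewrite sumr_const card_orderings -[RHS]mulr_natr natr_prod.
    rewrite mulfVK //; apply/prodf_neq0 => v _.
    by rewrite pnatr_eq0 -lt0n fact_gt0.
  apply: eq_bigr => o; rewrite inE => /forallP ho.
  rewrite plane_weight_erase plane_ofE /= (tree_factor_branch ht ho tu) mulrC mulKf //.
  apply/prodf_neq0 => v _.
  by rewrite pnatr_eq0 -lt0n fact_gt0.
rewrite -big_enum /=.
transitivity (\sum_(q <- [seq (erase (plane_of x), labels (plane_of x)) |
    x <- enum (ordered_trees n d)]) plane_weight q.1); first by rewrite big_map.
rewrite (perm_big _ plane_of_perm) big_allpairs_dep /= big_filter mulr_sumr.
apply: eq_bigr => P _; rewrite big_const_seq count_predT size_permutations ?enum_uniq //.
rewrite size_enum_ord iter_addr_0 mulr_natl; congr (_ *+ _).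
by rewrite plane_weightE /= /vertex_factor mul1r big_seq1.
Qed.

End CountTrees.

(** * Isomorphism classes *)

Section Isomorphism.
Variable n : nat.
Implicit Types (t : rtree n) (s : 'S_n).

Lemma card_perm_stable (T : finType) (s : {perm T}) (A B : {set T}) :
  (forall v, (s v \in B) = (v \in A)) -> #|B| = #|A|.
Proof.
move=> AB; rewrite -(card_imset A (@perm_inj _ s)); apply: eq_card => v.
by rewrite -[v](permKV s) AB mem_imset //; apply: perm_inj.
Qed.

Section Invariance.
Variables (s : 'S_n) (t1 t2 : rtree n).
Hypothesis st : is_isom s t1 t2.

Lemma isom_root : troot t2 = s (troot t1).
Proof. by case/andP: st => /eqP. Qed.

Lemma isom_parent v : parent t2 (s v) = s (parent t1 v).
Proof. by case/andP: st => _ /forallP/(_ v)/eqP. Qed.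

Lemma isom_above v w : above t2 (s v) (s w) = above t1 v w.
Proof.
have iterE i u : iter i (parent t2) (s u) = s (iter i (parent t1) u).
  by elim: i => //= i ->; apply: isom_parent.
apply/idP/idP => /iter_findex; rewrite ?iterE.
  by move/perm_inj <-; apply: fconnect_iter.
by move=> <-; rewrite -iterE; apply: fconnect_iter.
Qed.

Lemma isom_valency v : valency t2 (s v) = valency t1 v.
Proof.
apply: (card_perm_stable (s := s)) => w.
by rewrite !inE /adj !isom_parent !(inj_eq perm_inj).
Qed.

Lemma isom_leaves v : (s v \in leaves t2) = (v \in leaves t1).
Proof. by rewrite !inE isom_root isom_valency (inj_eq perm_inj). Qed.

Lemma isom_Vin v : (s v \in Vin t2) = (v \in Vin t1).
Proof. by rewrite !in_setC !in_setU1 isom_leaves isom_root (inj_eq perm_inj). Qed.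

Lemma isom_Vmov v : (s v \in Vmov t2) = (v \in Vmov t1).
Proof.
rewrite [LHS]in_set [RHS]in_set isom_Vin; congr (_ && _).
apply/forall_inP/forall_inP => mov u.
  by rewrite -isom_Vin => /mov; rewrite (inj_eq perm_inj) isom_above.
by rewrite -[u](permKV s) isom_Vin => /mov; rewrite (inj_eq perm_inj) isom_above.
Qed.

Lemma isom_leaf_number v : leaf_number t2 (s v) = leaf_number t1 v.
Proof.
apply: (card_perm_stable (s := s)) => w.
by rewrite [LHS]inE [RHS]inE isom_leaves isom_above.
Qed.

Lemma isom_tree_factor : tree_factor t2 = tree_factor t1.
Proof.
rewrite /tree_factor (card_perm_stable (s := s) (A := Vin t1 :\: Vmov t1)); last first.
  by move=> v; rewrite !in_setD isom_Vin isom_Vmov.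
congr (_ * _ * _); rewrite (reindex_inj (@perm_inj _ s)).
  by apply: eq_big => v; rewrite ?isom_Vin // isom_leaf_number isom_valency.
by apply: eq_big => v; rewrite ?isom_Vmov // isom_leaf_number.
Qed.

Lemma isom_un_trees d : t1 \in un_trees n d -> t2 \in un_trees n d.
Proof.
rewrite !inE => /and4P[/andP[/eqP pr /forallP ar] vr /eqP ld /forallP nb].
rewrite {1}/is_rtree isom_root isom_parent pr eqxx isom_valency vr.
rewrite (card_perm_stable isom_leaves) ld eqxx.
apply/and3P; split=> //; apply/forallP => v; rewrite -[v](permKV s).
  by rewrite isom_above.
by rewrite isom_valency.
Qed.

End Invariance.

(** The right action of permutations on rooted trees for which isomorphic means
    in the same orbit. *)
Definition relabel t s : rtree n :=
  (s (troot t), [ffun v => s (parent t ((s^-1)%g v))]).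

Lemma relabel1 t : relabel t 1%g = t.
Proof.
case: t => r p; rewrite /relabel perm1; congr (_, _).
by apply/ffunP => v; rewrite ffunE invg1 !perm1.
Qed.

Lemma relabelM t : act_morph relabel t.
Proof.
move=> s s'; rewrite /relabel permM; congr (_, _).
by apply/ffunP => v; rewrite !ffunE invMg !permM.
Qed.

Definition relabel_action := TotalAction relabel1 relabelM.

Lemma is_isomE s t1 t2 : is_isom s t1 t2 = (relabel t1 s == t2).
Proof.
rewrite /is_isom /relabel; case: t2 => r2 p2; rewrite xpair_eqE; congr (_ && _).
apply/forallP/eqP => [h|<- v]; last by rewrite /parent ffunE permK.
by apply/ffunP => v; rewrite ffunE (eqP (h _)) permKV.
Qed.

(** Orbit-stabilizer for [relabel_action]. *)
Lemma card_isomorphic t :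
  (#|[set t' | isomorphic t t']| * #|Aut_tree t| = n`!)%N.
Proof.
have := card_orbit_stab relabel_action [set: 'S_n] t.
rewrite cardsT card_Sn => <-; congr (_ * _)%N; apply: eq_card; [move=> t' | move=> s].
  rewrite inE; apply/existsP/orbitP => -[s].
    by rewrite is_isomE => /eqP st; exists s; rewrite ?inE.
  by move=> _ st; exists s; rewrite is_isomE -st.
rewrite inE is_isomE; apply/eqP/setIP => [st|[_ /astab1P //]].
by rewrite inE; split=> //; apply/astab1P.
Qed.

(** Each class contributes its size, [n! / |Aut t|], times a common factor. *)
Lemma sum_un_classes d :
  \sum_(t in un_classes n d) tree_weight t =
  (\sum_(t in un_trees n d) tree_factor t) / (n`!)%:R.
Proof.
set R := @isomorphic n; set D := un_trees n d; set P := equivalence_partition R D.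
have eqR : {in D & &, equivalence_rel R}.
  by move=> x y z _ _ _; apply: isomorphic_equiv.
have partP : partition P D := equivalence_partitionP eqR.
(* [un_classes] is itself an image set; abstracting it keeps [big_imset] from
   unfolding it. *)
move: (un_classesP n d); rewrite -/R -/D -/P; move: (un_classes n d) => X trX.
rewrite (set_partition_big _ partP) -(pblock_transversal trX).
rewrite big_imset /=; last exact: (pblock_inj trX).
rewrite mulr_suml; apply: eq_bigr => t tX.
have tD : t \in D := subsetP (transversal_sub trX) t tX.
have -> : pblock P t = [set t' | isomorphic t t'].
  apply/setP => t'; rewrite inE; case: (boolP (t' \in D)) => t'D.
    exact: (pblock_equivalence_partition eqR tD t'D).
  transitivity false.
    apply: contraNF t'D => t't; rewrite -(cover_partition partP).
    by apply/bigcupP; exists (pblock P t); rewrite // pblock_mem ?(cover_partition partP).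
  by apply/esym; apply: contraNF t'D => /existsP[s st]; apply: isom_un_trees st _ tD.
rewrite (eq_bigr (fun=> tree_factor t)); last first.
  by move=> t'; rewrite inE => /existsP[s]; apply: isom_tree_factor.
rewrite sumr_const -(card_isomorphic t) natrM -[tree_factor t *+ _]mulr_natr.
have : (n`!%:R : rat) != 0 by rewrite pnatr_eq0 -lt0n fact_gt0.
rewrite -(card_isomorphic t) natrM mulf_eq0 negb_or => /andP[o0 a0].
by rewrite /tree_weight /tree_factor; field; rewrite a0 o0.
Qed.

End Isomorphism.

Theorem corollary2 (T : nat -> rat) (hT : superpotential_recursion T)
    (d : nat) (hd : (0 < d)%N) :
  tildeT T d =
    2 ^+ d * \sum_(n < (2 * d).+1) \sum_(t in un_classes n d) tree_weight t.
Proof.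
rewrite tildeT_plane_sum //; congr (_ * _); rewrite /plane_sum.
rewrite (eq_bigr (fun n : 'I_(2 * d).+1 => \sum_(P <- plane_trees d d)
   if (size (subtrees P)).+1 == n then plane_weight P else 0)); last first.
  move=> n _; rewrite sum_un_classes sum_tree_factor mulrC mulKf ?big_mkcond //.
  by rewrite pnatr_eq0 -lt0n fact_gt0.
(* A plane tree is counted for the single [n] that exceeds its number of vertices
   by one, and [unary_free_size] says that this [n] is in the range. *)
rewrite exchange_big /= big_seq [RHS]big_seq; apply: eq_bigr => P.
rewrite mem_plane_trees // => /andP[uP /eqP Pd].
have szP : ((size (subtrees P)).+1 < (2 * d).+1)%N by rewrite ltnS -Pd unary_free_size.
by rewrite -big_mkcond (big_pred1 (Ordinal szP)) // => n.
Qed.
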